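(* Let $\ell\ge 1$ and let $G=A_\ell$ or $G=C_\ell$. Let $M(\cdot\,;\cdot\,;G)$ and $M^*(\cdot\,;\cdot\,;G)$ be the infinite matrices defined in the context, with rows and columns indexed by $\mathbb{Z}_{\ge0}^{\ell}$ and ordered lexicographically. Then $M$ and $M^*$ are inverse, infinite, lower-triangular matrices. That is, for all $\mathbf{i},\mathbf{j}\in\mathbb{Z}_{\ge0}^{\ell}$, $$\prod_{k=1}^{\ell}\delta(i_k,j_k)=\sum_{\substack{\mathbf{y}\in\mathbb{Z}_{\ge0}^{\ell}\\ j_k\le y_k\le i_k,\ k=1,\dots,\ell}} M(\mathbf{i};\mathbf{y};G)\,M^*(\mathbf{y};\mathbf{j};G),$$ where $\delta(r,s)=1$ if $r=s$ and $\delta(r,s)=0$ otherwise.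
   Context: Let $q$ be a complex number with $0<|q|<1$. Put $(\alpha)_\infty=\prod_{k\ge0}(1-\alpha q^k)$ and, for every integer $n$, $(\alpha)_n=(\alpha)_\infty/(\alpha q^n)_\infty$; i.e. $(\alpha)_n=\prod_{k=0}^{n-1}(1-\alpha q^k)$ for $n\ge0$ and $(\alpha)_{-n}=\prod_{k=1}^{n}(1-\alpha q^{-k})^{-1}$ for $n>0$. In particular $1/(q)_n=0$ for $n<0$. Vectors $\mathbf{i},\mathbf{j},\mathbf{y}$ have length $\ell$ with nonnegative integer components; write $|\mathbf{i}|=i_1+\cdots+i_\ell$. Let $a,x_1,\dots,x_\ell$ be indeterminates (the $a$ only being used for $A_\ell$), and suppose none of the denominators in the definitions below vanishes. Case $A_\ell$: $$M(\mathbf{i};\mathbf{j};A_\ell)=\prod_{r,s=1}^{\ell}\left(q\tfrac{x_r}{x_s}q^{j_r-j_s}\right)_{i_r-j_r}^{-1}\ \prod_{k=1}^{\ell}\left(aq\tfrac{x_k}{x_\ell}\right)_{i_k+|\mathbf{j}|}^{-1},$$ $$M^*(\mathbf{i};\mathbf{j};A_\ell)=\prod_{k=1}^{\ell}\left[1-a\tfrac{x_k}{x_\ell}q^{i_k+|\mathbf{i}|}\right]\prod_{k=1}^{\ell}\left(aq\tfrac{x_k}{x_\ell}\right)_{j_k+|\mathbf{i}|-1}\ \prod_{r,s=1}^{\ell}\left(q\tfrac{x_r}{x_s}q^{j_r-j_s}\right)_{i_r-j_r}^{-1}\ (-1)^{|\mathbf{i}|-|\mathbf{j}|}q^{\binom{|\mathbf{i}|-|\mathbf{j}|}{2}}.$$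 Case $C_\ell$: $$M(\mathbf{i};\mathbf{j};C_\ell)=\prod_{r,s=1}^{\ell}\left[\left(q\tfrac{x_r}{x_s}q^{j_r-j_s}\right)_{i_r-j_r}^{-1}\left(q x_rx_sq^{j_r+j_s}\right)_{i_r-j_r}^{-1}\right],$$ $$M^*(\mathbf{i};\mathbf{j};C_\ell)=\prod_{r,s=1}^{\ell}\left[\left(q\tfrac{x_r}{x_s}q^{j_r-j_s}\right)_{i_r-j_r}^{-1}\left(x_rx_sq^{j_r+i_s}\right)_{i_r-j_r}^{-1}\right]\prod_{1\le r<s\le\ell}\left[\frac{1-x_rx_sq^{j_r+j_s}}{1-x_rx_sq^{i_r+i_s}}\right](-1)^{|\mathbf{i}|-|\mathbf{j}|}q^{\binom{|\mathbf{i}|-|\mathbf{j}|}{2}}.$$ The factors with $r=s$ contain $1/(q)_{i_r-j_r}$, so all these entries are $0$ unless $j_k\le i_k$ for every $k$. *)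

(* Defs.v *)
From HB Require Import structures.
From mathcomp Require Import all_boot all_order all_algebra.
From mathcomp Require Import reals.
From mathcomp.real_closed Require Import complex.

Set Implicit Arguments.
Unset Strict Implicit.
Unset Printing Implicit Defensive.

Import Order.TTheory GRing.Theory Num.Theory.
Local Open Scope ring_scope.

(* The rank is l.+1 throughout, so that it is at least 1 and the last
   variable (x_l in the usual 1-based numbering) is [x ord_max]. *)
Definition multiindex (l : nat) := 'I_l.+1 -> nat.

Definition weight (l : nat) (i : multiindex l) : nat := (\sum_k i k)%N.

Section Matrices.
Variable K : fieldType.

(* The base is q, and [n] may be any integer: [Negz m] is -(m+1).
   Since 0^-1 = 0, [(qpoch q q n)^-1 = 0] for n < 0, as it should be. *)
Definition qpoch (q al : K) (n : int) : K :=
  match n with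
  | Posz m => \prod_(0 <= k < m) (1 - al * q ^+ k)
  | Negz m => \prod_(1 <= k < m.+2) (1 - al * q ^- k)^-1
  end.

Variable l : nat.
Implicit Types (q a : K) (x : 'I_l.+1 -> K) (i j : multiindex l).

(* (-1)^d q^(binomial(d, 2)) with d = |i| - |j|; the division is exact. *)
Definition signed_qpow q i j : K :=
  let d := (weight i)%:Z - (weight j)%:Z in
  (-1) ^ d * q ^ ((d * (d - 1)) %/ 2)%Z.

Definition MA q a x i j : K :=
  (\prod_r \prod_s
     (qpoch q (q * (x r / x s) * q ^ ((j r)%:Z - (j s)%:Z))
              ((i r)%:Z - (j r)%:Z))^-1)
  * \prod_k (qpoch q (a * q * (x k / x ord_max))
                   ((i k)%:Z + (weight j)%:Z))^-1.

Definition MAstar q a x i j : K :=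
  (\prod_k (1 - a * (x k / x ord_max) * q ^+ (i k + weight i)))
  * (\prod_k qpoch q (a * q * (x k / x ord_max))
                   ((j k)%:Z + (weight i)%:Z - 1))
  * (\prod_r \prod_s
       (qpoch q (q * (x r / x s) * q ^ ((j r)%:Z - (j s)%:Z))
                ((i r)%:Z - (j r)%:Z))^-1)
  * signed_qpow q i j.

Definition MC q x i j : K :=
  \prod_r \prod_s
    ((qpoch q (q * (x r / x s) * q ^ ((j r)%:Z - (j s)%:Z))
              ((i r)%:Z - (j r)%:Z))^-1
     * (qpoch q (q * x r * x s * q ^+ (j r + j s))
                ((i r)%:Z - (j r)%:Z))^-1).

Definition MCstar q x i j : K :=
  (\prod_r \prod_s
     ((qpoch q (q * (x r / x s) * q ^ ((j r)%:Z - (j s)%:Z))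
               ((i r)%:Z - (j r)%:Z))^-1
      * (qpoch q (x r * x s * q ^+ (j r + i s))
                 ((i r)%:Z - (j r)%:Z))^-1))
  * (\prod_(r < l.+1) \prod_(s < l.+1 | (r < s)%N)
       ((1 - x r * x s * q ^+ (j r + j s))
        / (1 - x r * x s * q ^+ (i r + i s))))
  * signed_qpow q i j.

(* No denominator vanishes.  Only indices with j_r <= i_r matter: in the
   remaining entries the factor r = s contributes 1/(q)_(i_r-j_r) = 0, and
   reciprocals of Pochhammer symbols of negative index are polynomial. *)
Definition denominators_neq0_A q a x : Prop :=
  [/\ forall r, x r != 0,
      forall i j (r s : 'I_l.+1), r != s -> (j r <= i r)%N ->
        qpoch q (q * (x r / x s) * q ^ ((j r)%:Z - (j s)%:Z))
              ((i r)%:Z - (j r)%:Z) != 0,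
      forall i j k,
        qpoch q (a * q * (x k / x ord_max))
              ((i k)%:Z + (weight j)%:Z) != 0
    & (* denominator of the Pochhammer symbol of index j_k + |i| - 1 = -1
         occurring in MAstar *)
      forall k, 1 - a * (x k / x ord_max) != 0].

Definition denominators_neq0_C q x : Prop :=
  [/\ forall r, x r != 0,
      forall i j (r s : 'I_l.+1), r != s -> (j r <= i r)%N ->
        qpoch q (q * (x r / x s) * q ^ ((j r)%:Z - (j s)%:Z))
              ((i r)%:Z - (j r)%:Z) != 0,
      forall i j r s, (j r <= i r)%N ->
        qpoch q (q * x r * x s * q ^+ (j r + j s))
              ((i r)%:Z - (j r)%:Z) != 0,
      forall i j r s, (j r <= i r)%N ->
        qpoch q (x r * x s * q ^+ (j r + i s))
              ((i r)%:Z - (j r)%:Z) != 0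
    & forall i (r s : 'I_l.+1), (r < s)%N -> 1 - x r * x s * q ^+ (i r + i s) != 0].

Definition lex_lt i j : Prop :=
  exists k : 'I_l.+1,
    (forall s : 'I_l.+1, (s < k)%N -> i s = j s) /\ (i k < j k)%N.

Definition lower_triangular (M : multiindex l -> multiindex l -> K) : Prop :=
  forall i j, lex_lt i j -> M i j = 0.

(* Sum over the y with j_k <= y_k <= i_k for all k; such y satisfy
   y_k <= |i|, which makes the summation range a finite type. *)
Definition matprod (M N : multiindex l -> multiindex l -> K) i j : K :=
  \sum_(y : {ffun 'I_l.+1 -> 'I_(weight i).+1}
        | [forall k, (j k <= y k <= i k)%N])
     M i (fun k => y k : nat) * N (fun k => y k : nat) j.

Definition delta i j : K := \prod_k (i k == j k)%:R.

Definition inverse_lower_triangular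
    (M N : multiindex l -> multiindex l -> K) : Prop :=
  [/\ lower_triangular M, lower_triangular N,
      forall i j, delta i j = matprod M N i j
    & forall i j, delta i j = matprod N M i j].

End Matrices.

(* Main.v *)
Require Import Defs.
From HB Require Import structures.
From mathcomp Require Import all_boot all_order all_algebra.
From mathcomp Require Import reals.
From mathcomp.real_closed Require Import complex.
From Stdlib Require Import FunctionalExtensionality.
From mathcomp Require Import zify ring.

Set Implicit Arguments.
Unset Strict Implicit.
Unset Printing Implicit Defensive.

Import Order.TTheory GRing.Theory Num.Theory.
Local Open Scope ring_scope.

(* Put z_s = x_s q^(y_s).  Up to a factor independent of y, each summand of a
   product of the two matrices has the form

     prod_(r < s) (n_s - n_r) * prod_s h(n_s) / prod_(n <> n_s) (n_s - n),

   where n_s is a node attached to (s, y_s) and n runs over the nodes attached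
   to all (r, t) with j_r <= t <= i_r.  Expanding the Vandermonde product, the
   sum over y becomes a determinant, and by Lagrange interpolation its rows add
   up to 0 as soon as deg h < |i| - |j|.

   For A_l this applies to M^* M, with n_s = z_s: there the factors involving a
   combine to such a polynomial h, whereas in M M^* they do not separate.  For
   C_l it applies to M M^*, with n_s = z_s + 1 / z_s and h = 1.  The other
   product follows because a one-sided inverse of a finite square matrix is
   two-sided. *)

(** * Lagrange interpolation and Vandermonde determinants *)

(** The interpolation polynomial of [p] at the points [c i] is [p] itself, since both have size at
    most [#|P|] and agree at [#|P|] distinct points. The sum is its coefficient of degree
    [#|P| - 1], because every [L i] is monic of that degree, and this coefficient of [p] is 0. *)
Lemma sum_horner_lagrange_weights (K : fieldType) (I : finType) (P : pred I)
    (c : I -> K) (p : {poly K}) :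
  {in P &, injective c} -> (size p < #|P|)%N ->
  \sum_(i | P i) p.[c i] / \prod_(k | P k && (k != i)) (c i - c k) = 0.
Proof.
move=> injc szp.
pose L i := \prod_(k | P k && (k != i)) ('X - (c k)%:P).
pose w i := \prod_(k | P k && (k != i)) (c i - c k).
have w_neq0 i : P i -> w i != 0.
  move=> Pi; apply/prodf_neq0 => k /andP[Pk ki].
  by rewrite subr_eq0; apply: contraNneq ki => /injc ->.
have LiE i : (L i).[c i] = w i.
  by rewrite horner_prod; apply: eq_bigr => k _; rewrite hornerXsubC.
have LkE i k : P k -> k != i -> (L i).[c k] = 0.
  move=> Pk ki; rewrite horner_prod (bigD1 k) /=; last by rewrite Pk.
  by rewrite hornerXsubC subrr mul0r.
have szL i : P i -> size (L i) = #|P|.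
  move=> Pi; have -> : L i = \prod_(k <- enum [pred k | P k && (k != i)]) ('X - (c k)%:P).
    by rewrite big_enum.
  by rewrite size_prod_XsubC -cardE -add1n -cardD1x.
have monL i : L i \is monic by apply: monic_prod_XsubC.
pose g := \sum_(i | P i) (p.[c i] / w i) *: L i.
have gE : g = p.
  apply/eqP; rewrite -subr_eq0; apply/eqP.
  apply: (@roots_geq_poly_eq0 _ _ [seq c i | i <- enum P]).
  - apply/allP => _ /mapP[i + ->]; rewrite mem_enum => Pi.
    rewrite rootE hornerD hornerN horner_sum (bigD1 i Pi) /= big1.
      by rewrite hornerZ LiE divfK ?w_neq0// addr0 subrr.
    by move=> k /andP[Pk ki]; rewrite hornerZ LkE ?mulr0// eq_sym.
  - rewrite map_inj_in_uniq ?enum_uniq// => i k; rewrite !mem_enum.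
    exact: injc.
  rewrite size_map -cardE (leq_trans (size_polyD _ _))// geq_max size_polyN.
  rewrite (ltnW szp) andbT (leq_trans (size_sum _ _ _))//.
  apply/bigmax_leqP => i Pi; rewrite (leq_trans (size_scale_leq _ _))//.
  by rewrite szL.
transitivity g`_#|P|.-1; last by rewrite gE nth_default// -ltnS prednK// (leq_trans _ szp).
rewrite coef_sum; apply: eq_bigr => i Pi; rewrite coefZ -(szL i Pi).
by rewrite (_ : (L i)`__ = lead_coef (L i))// (monicP (monL i)) mulr1.
Qed.

(** Row [s] of the Vandermonde matrix depends on [y s] only, so by multilinearity the sum over the
    box is the determinant of the matrix of row-wise sums. The hypothesis says that the rows of that
    matrix add up to 0. *)
Lemma sum_box_vandermonde (K : fieldType) (l d : nat) (i j : multiindex l)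
    (N G : 'I_l.+1 -> nat -> K) :
  (forall b : 'I_l.+1,
     \sum_s \sum_(t < d | (j s <= t <= i s)%N) G s t * N s t ^+ b = 0) ->
  \sum_(y : {ffun 'I_l.+1 -> 'I_d} | [forall k, (j k <= y k <= i k)%N])
    (\prod_s G s (y s)) *
    \prod_(r < l.+1) \prod_(s < l.+1 | (r < s)%N) (N s (y s) - N r (y r)) = 0.
Proof.
move=> GN0.
pose B := \matrix_(s < l.+1, b < l.+1)
  \sum_(t < d | (j s <= t <= i s)%N) G s t * N s t ^+ b.
transitivity (\det B); last first.
  apply/eqP/det0P; exists (const_mx 1).
    by apply/eqP => /matrixP/(_ 0 0)/eqP; rewrite !mxE oner_eq0.
  apply/rowP => b; rewrite !mxE -[RHS](GN0 b); apply: eq_bigr => s _.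
  by rewrite !mxE mul1r.
pose V (y : {ffun 'I_l.+1 -> 'I_d}) := Vandermonde l.+1 (\row_s N s (y s)).
have detV (y : {ffun 'I_l.+1 -> 'I_d}) : \prod_(r < l.+1) \prod_(s < l.+1 | (r < s)%N)
    (N s (y s) - N r (y r)) = \det (V y)^T.
  rewrite det_tr det_Vandermonde; apply: eq_bigr => r _; apply: eq_bigr => s _.
  by rewrite !mxE.
under eq_bigr do rewrite detV big_distrr /=.
rewrite exchange_big; apply: eq_bigr => sg _ /=.
under eq_bigr do rewrite mulrCA -big_split/=.
rewrite -big_distrr/=; congr (_ * _).
under [RHS]eq_bigr do rewrite mxE.
(* For a fixed permutation, the product over [s] of sums over [t] expands into a sum over the
   choices [y] of one [t] for each [s]. *)
rewrite bigA_distr_big_dep; apply: eq_big => [y|y _].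
  apply/forallP/familyP => yP k; exact: yP.
by apply: eq_bigr => s _; rewrite !mxE.
Qed.

Lemma big_mkord_itv (R : Type) (idx : R) (op : Monoid.law idx) (d m n : nat)
    (P : pred nat) (F : nat -> R) : (n < d)%N ->
  \big[op/idx]_(t < d | (m <= t <= n)%N && P t) F t =
  \big[op/idx]_(m <= t < n.+1 | P t) F t.
Proof.
move=> nd; rewrite (big_nat_widen _ _ d)// big_geq_mkord.
by apply: eq_bigl => t /=; rewrite ltnS; case: (P t); rewrite /= ?andbF ?andbT// andbC.
Qed.

(* The pairs [(r, t)] label the nodes; [(s, y s)] is the node chosen for [s]. *)
Definition node_complement (K : fieldType) (l : nat) (i j y : multiindex l)
    (f : 'I_l.+1 -> 'I_l.+1 -> nat -> K) : K :=
  \prod_s \prod_r \prod_(j r <= t < (i r).+1 | (r != s) || (t != y s)) f s r t.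

(** The entries of the Vandermonde matrix contribute powers ['X^b] with [b <= l], so interpolation
    is applied to [h * 'X^b]. Its size is at most [\sum_r (i r - j r) + l], one less than the number
    of nodes, which explains the bound on [h]. *)
Lemma sum_box_lagrange (K : fieldType) (l d : nat) (i j : multiindex l)
    (N : 'I_l.+1 -> nat -> K) (h : {poly K}) :
  (forall r, j r <= i r < d)%N -> (size h <= \sum_r (i r - j r))%N ->
  (forall r s t t', (j r <= t <= i r)%N -> (j s <= t' <= i s)%N ->
     (r != s) || (t != t') -> N r t != N s t') ->
  \sum_(y : {ffun 'I_l.+1 -> 'I_d} | [forall k, (j k <= y k <= i k)%N])
    (\prod_s h.[N s (y s)]) *
    (\prod_(r < l.+1) \prod_(s < l.+1 | (r < s)%N) (N s (y s) - N r (y r))) /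
    node_complement i j (fun k => y k) (fun s r t => N s (y s) - N r t) = 0.
Proof.
move=> jid szh injN.
pose W s t := \prod_r \prod_(j r <= t' < (i r).+1 | (r != s) || (t' != t))
  (N s t - N r t').
transitivity (\sum_(y : {ffun 'I_l.+1 -> 'I_d} | [forall k, (j k <= y k <= i k)%N])
    (\prod_s (h.[N s (y s)] / W s (y s))) *
    (\prod_(r < l.+1) \prod_(s < l.+1 | (r < s)%N) (N s (y s) - N r (y r)))).
  by apply: eq_bigr => y _; rewrite prodf_div mulrAC.
apply: (@sum_box_vandermonde K l d i j N (fun s t => h.[N s t] / W s t)) => b.
pose P (u : 'I_l.+1 * 'I_d) := (j u.1 <= u.2 <= i u.1)%N.
pose c (u : 'I_l.+1 * 'I_d) := N u.1 u.2.
rewrite pair_big_dep/=.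
transitivity (\sum_(u | P u) (h * 'X^b).[c u] /
   \prod_(k | P k && (k != u)) (c u - c k)); last first.
  apply: sum_horner_lagrange_weights.
    move=> [r t] [s t'] rtP stP; apply: contra_eq; rewrite xpair_eqE negb_and.
    by move=> ne; apply: injN.
  have -> : #|P| = (\sum_r (i r - j r).+1)%N.
    rewrite -sum1_card (eq_bigl (fun u : 'I_l.+1 * 'I_d => true && P u))//.
    rewrite -(pair_big_dep xpredT (fun r (t : 'I_d) => P (r, t)) (fun _ _ => 1%N))/=.
    apply: eq_bigr => r _.
    have /andP[jr ir] := jid r.
    transitivity (\sum_(t < d | (j r <= t <= i r)%N && true) 1)%N.
      by apply: eq_bigl => t; rewrite andbT.
    rewrite (@big_mkord_itv _ _ addn d (j r) (i r) xpredT (fun=> 1%N))//.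
    by rewrite sum_nat_const_nat muln1 subSn.
  apply: (leq_ltn_trans (size_polyMleq _ _)).
  rewrite size_polyXn addnS/=.
  have -> : (\sum_r (i r - j r).+1 = \sum_r (i r - j r) + l.+1)%N.
    under eq_bigr do rewrite -addn1.
    by rewrite big_split/= sum_nat_const card_ord muln1.
  by rewrite -addnS leq_add.
apply: eq_bigr => -[s t] _ /=.
rewrite hornerM hornerXn mulrAC; congr (_ / _).
rewrite (eq_bigl (fun u : 'I_l.+1 * 'I_d => true && (P u && ((u.1 != s) || (u.2 != t)))));
  last by move=> [r t'] /=; rewrite xpair_eqE negb_and.
rewrite -(pair_big_dep xpredT
  (fun r (t' : 'I_d) => P (r, t') && ((r != s) || (t' != t)))
  (fun r t' => N s t - N r t'))/=.
apply: eq_bigr => r _; have /andP[jr ir] := jid r.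
by rewrite -(big_mkord_itv _ _ (fun t' : nat => (r != s) || (t' != t)) _ ir).
Qed.

(** * Products of differences of the nodes *)

Lemma big_ord_pairs (R : Type) (idx : R) (op : Monoid.com_law idx) (l : nat)
    (f : 'I_l -> 'I_l -> R) :
  \big[op/idx]_r \big[op/idx]_s f r s =
  op (\big[op/idx]_r f r r)
     (\big[op/idx]_(r < l) \big[op/idx]_(s < l | (r < s)%N) op (f r s) (f s r)).
Proof.
have trichotomy (r : 'I_l) : \big[op/idx]_s f r s =
    op (f r r) (op (\big[op/idx]_(s < l | (r < s)%N) f r s)
                   (\big[op/idx]_(s < l | (s < r)%N) f r s)).
  rewrite (bigD1 r)//=; congr (op _ _).
  rewrite (bigID (fun s : 'I_l => (r < s)%N))/=.
  congr (op _ _); apply: eq_bigl => s; rewrite -(inj_eq val_inj)/=; lia.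
under eq_bigr do rewrite trichotomy.
rewrite !big_split/=; congr (op _ _).
under [in RHS]eq_bigr do rewrite big_split/=.
rewrite big_split/=; congr (op _ _).
under eq_bigr do rewrite big_mkcond/=.
rewrite exchange_big/=; apply: eq_bigr => r _.
by rewrite [RHS]big_mkcond.
Qed.

(** A form of the binomial coefficient without subtraction or division, suited to linear
    arithmetic. *)
Lemma sqrn_bin2 (n : nat) : (n * n = 2 * 'C(n, 2) + n)%N.
Proof. by elim: n => // n IH; rewrite binS bin1; lia. Qed.

(** Obtained by expanding the square of the sum. It splits a power of [q] with exponent
    ['C(|y| - |j|, 2)] into diagonal and pairwise contributions. *)
Lemma bin2_sum_pairs (l : nat) (m : 'I_l -> nat) :
  'C(\sum_r m r, 2) =
  (\sum_r 'C(m r, 2) + \sum_(r < l) \sum_(s < l | (r < s)%N) m r * m s)%N.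
Proof.
have : ((\sum_r m r) * (\sum_r m r) =
    \sum_r (m r * m r) + \sum_(r < l) \sum_(s < l | (r < s)%N) (m r * m s + m s * m r))%N.
  rewrite -(@big_ord_pairs _ _ addn _ (fun r s => m r * m s)%N) big_distrl/=.
  by apply: eq_bigr => r _; rewrite big_distrr.
rewrite sqrn_bin2; under [X in _ = (X + _)%N]eq_bigr do rewrite sqrn_bin2.
rewrite [X in _ = (X + _)%N]big_split/= -big_distrr/=.
have -> : (\sum_(r < l) \sum_(s < l | (r < s)%N) (m r * m s + m s * m r) =
   2 * \sum_(r < l) \sum_(s < l | (r < s)%N) m r * m s)%N.
  rewrite big_distrr/=; apply: eq_bigr => r _; rewrite big_distrr/=.
  by apply: eq_bigr => s _; rewrite mulnC addnn mul2n.
move=> e; apply/eqP; rewrite -(eqn_pmul2l (isT : (0 < 2)%N)).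
by rewrite -(eqn_add2r (\sum_r m r)) e mulnDr addnAC.
Qed.

(** Each range of [t] is cut at [y r]. The nodes with [t = y r] survive only for [r != s], and there
    they are grouped by unordered pairs. *)
Lemma node_complementE (K : fieldType) (l : nat) (i j y : multiindex l)
    (f : 'I_l.+1 -> 'I_l.+1 -> nat -> K) :
  (forall r, j r <= y r <= i r)%N ->
  node_complement i j y f =
  (\prod_s \prod_r \prod_(j r <= t < y r) f s r t) *
  (\prod_s \prod_r \prod_((y r).+1 <= t < (i r).+1) f s r t) *
  \prod_(r < l.+1) \prod_(s < l.+1 | (r < s)%N) (f s r (y r) * f r s (y s)).
Proof.
move=> jyi; rewrite /node_complement.
pose g s r := if r == s then 1 else f s r (y r).
have -> : \prod_(r < l.+1) \prod_(s < l.+1 | (r < s)%N)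
    (f s r (y r) * f r s (y s)) = \prod_s \prod_r g s r.
  rewrite big_ord_pairs/= [X in _ = X * _]big1 ?mul1r; last by move=> r _; rewrite /g eqxx.
  apply: eq_bigr => r _; apply: eq_bigr => s rs.
  by rewrite /g -!(inj_eq val_inj)/= gtn_eqF// ltn_eqF// mulrC.
rewrite -!big_split/=; apply: eq_bigr => s _.
rewrite -!big_split/=; apply: eq_bigr => r _.
have /andP[jr yr] := jyi r.
rewrite (big_cat_nat _ (n := y r))//=; last by lia.
rewrite [X in _ * X = _]big_mkcond big_ltn//= -big_mkcond/= -mulrA; congr (_ * _).
  rewrite big_nat_cond [RHS]big_nat_cond; apply: eq_bigl => t.
  rewrite andbT; case: eqVneq => [->|]; rewrite ?andbT//=.
  by case: ltngtP; rewrite ?andbF ?andbT.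
rewrite /g mulrC; case: eqVneq => [->|_] /=; rewrite ?eqxx/=; congr (_ * _).
rewrite big_nat_cond [RHS]big_nat_cond; apply: eq_bigl => t.
by rewrite andbT; case: ltngtP; rewrite ?andbF ?andbT.
Qed.

(* Both sides are, up to sign and powers of q, the product of [A - B q^e] over
   [- m <= e <= p]; induction on [p] avoids negative exponents. *)
Lemma prod_qnodes_pair (K : fieldType) (q A B : K) (m p : nat) :
  (\prod_(0 <= t < p) (A * q ^+ m - B * q ^+ t)) *
  (\prod_(0 <= t < m) (B * q ^+ p - A * q ^+ t)) * (A * q ^+ m - B * q ^+ p) =
  (A - B) * q ^+ (m * p) * (\prod_(1 <= t < p.+1) (A - B * q ^+ t)) *
  \prod_(1 <= t < m.+1) (B - A * q ^+ t).
Proof.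
elim: p => [|p IH].
  rewrite big_nil [X in _ = _ * X * _]big_geq// muln0 !expr0 !mulr1 !mul1r.
  have : \prod_(0 <= t < m.+1) (B - A * q ^+ t) =
     (B - A) * \prod_(1 <= t < m.+1) (B - A * q ^+ t).
    by rewrite big_nat_recl// expr0 mulr1 [in RHS]big_add1.
  rewrite big_nat_recr//= => e.
  by rewrite -opprB mulrN e -mulNr opprB.
rewrite big_nat_recr//= [in RHS]big_nat_recr//= mulnS exprD.
(* Both sides are the product over [t <= m]; isolating [t = 0] instead of [t = m] lets a factor [q]
   be pulled out of every other term. *)
have shift : (\prod_(0 <= t < m) (B * q ^+ p.+1 - A * q ^+ t)) *
    (B * q ^+ p.+1 - A * q ^+ m) =
    (B * q ^+ p.+1 - A) * (q ^+ m * \prod_(0 <= t < m) (B * q ^+ p - A * q ^+ t)).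
  rewrite -(big_nat_recr m 0 (fun t => B * q ^+ p.+1 - A * q ^+ t))//=.
  rewrite big_nat_recl// expr0 mulr1; congr (_ * _).
  have -> : q ^+ m = \prod_(0 <= t < m) q by rewrite prodr_const_nat subn0.
  rewrite -big_split/=.
  by apply: eq_bigr => t _; rewrite !exprS; ring.
move: IH shift.
set P1 := \prod_(0 <= t < p) _; set P2 := \prod_(0 <= t < m) _.
set P3 := \prod_(0 <= t < m) _; set P4 := \prod_(1 <= t < p.+1) _.
set P5 := \prod_(1 <= t < m.+1) _ => IH shift.
transitivity ((P1 * P2 * (A * q ^+ m - B * q ^+ p)) *
   (q ^+ m * (A - B * q ^+ p.+1))); last by rewrite IH; ring.
transitivity (P1 * (A * q ^+ m - B * q ^+ p) * - (P3 * (B * q ^+ p.+1 - A * q ^+ m))).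
  by ring.
by rewrite shift; ring.
Qed.

(** Each factor equals [- q ^+ t * (A - A * q ^+ (m - t))]; the exponents [t] add up to ['C(m, 2)],
    and the remaining product is reversed. *)
Lemma prod_qnodes_diag (K : fieldType) (q A : K) (m : nat) :
  \prod_(0 <= t < m) (A * q ^+ m - A * q ^+ t) =
  (-1) ^+ m * q ^+ 'C(m, 2) * \prod_(1 <= t < m.+1) (A - A * q ^+ t).
Proof.
have -> : (-1) ^+ m = \prod_(0 <= t < m) (-1) :> K by rewrite prodr_const_nat subn0.
rewrite -bin2_sum -prodrXr.
rewrite big_add1/= [X in _ = _ * X]big_nat_rev/= add0n -!big_split/=.
rewrite big_nat_cond [RHS]big_nat_cond; apply: eq_bigr => t /andP[/andP[_ tm] _].
have -> : (m - t.+1).+1 = (m - t)%N by lia.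
by rewrite mulN1r mulNr -mulrN opprB mulrBr [q ^+ t * A]mulrC mulrCA -exprD subnKC// ltnW.
Qed.

(** * Pochhammer symbols as products over the nodes *)

Lemma qpoch_subn (K : fieldType) (q al : K) (m n : nat) : (m <= n)%N ->
  qpoch q al (n%:Z - m%:Z) = \prod_(0 <= k < n - m) (1 - al * q ^+ k).
Proof. by move=> mn; rewrite subzn. Qed.

(** Clearing the denominator [v * q ^+ p] from each factor leaves differences of nodes, with natural
    exponents only. *)
Lemma qpoch_homogeneous (K : fieldType) (q u v : K) (m n p : nat) :
  q != 0 -> v != 0 -> (m <= n)%N ->
  qpoch q (q * (u / v) * q ^ (m%:Z - p%:Z)) (n%:Z - m%:Z) =
  (v * q ^+ p) ^- (n - m) * \prod_(m.+1 <= t < n.+1) (v * q ^+ p - u * q ^+ t).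
Proof.
move=> q0 v0 mn; rewrite qpoch_subn// -exprVn.
have -> : (v * q ^+ p)^-1 ^+ (n - m) = \prod_(0 <= t < n - m) (v * q ^+ p)^-1.
  by rewrite prodr_const_nat subn0.
rewrite -{1}(add0n m.+1) big_addn subSS -big_split/=; apply: eq_bigr => t _.
rewrite expfzDr// -exprnN -exprnP addnS exprS exprD; field.
by rewrite v0 expf_neq0.
Qed.

(** The reciprocal of this product is a factor common to the entries of all four matrices. *)
Definition mixed_qpoch (K : fieldType) (q : K) (l : nat) (x : 'I_l.+1 -> K)
    (i j : multiindex l) : K :=
  \prod_r \prod_s qpoch q (q * (x r / x s) * q ^ ((j r)%:Z - (j s)%:Z))
    ((i r)%:Z - (j r)%:Z).

Lemma weight_le (l : nat) (i j : multiindex l) :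
  (forall k, j k <= i k)%N -> (weight j <= weight i)%N.
Proof. by move=> ji; apply: leq_sum. Qed.

Lemma weightB (l : nat) (i j : multiindex l) : (forall k, j k <= i k)%N ->
  (weight i - weight j = \sum_k (i k - j k))%N.
Proof. by move=> ji; rewrite /weight sumnB. Qed.

Section QNodes.
Variables (K : fieldType) (q : K) (l : nat) (x : 'I_l.+1 -> K).
Hypotheses (q0 : q != 0) (x0 : forall r, x r != 0).
Implicit Types i j y : multiindex l.

Lemma mixed_qpochE i j : (forall k, j k <= i k)%N ->
  mixed_qpoch q x i j = (\prod_s (x s * q ^+ j s)) ^- (weight i - weight j) *
    \prod_s \prod_r \prod_((j r).+1 <= t < (i r).+1) (x s * q ^+ j s - x r * q ^+ t).
Proof.
move=> ji; rewrite /mixed_qpoch exchange_big/= -prodrXl -prodfV -big_split/=.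
apply: eq_bigr => s _; rewrite weightB// expr_sum -prodfV -big_split/=.
by apply: eq_bigr => r _; rewrite qpoch_homogeneous.
Qed.

(** Exchanges the base points [x s * q ^+ y s], compared with nodes below [y r], for the base points
    [x s * q ^+ j s], compared with nodes above [j r]. The terms [r = s] follow from
    [prod_qnodes_diag], the pairs from [prod_qnodes_pair] with the help of one Vandermonde factor,
    and the powers of [q] combine by [bin2_sum_pairs]. *)
Lemma prod_qnodes_below j y : (forall k, j k <= y k)%N ->
  (\prod_s \prod_r \prod_(j r <= t < y r) (x s * q ^+ y s - x r * q ^+ t)) *
  (\prod_(r < l.+1) \prod_(s < l.+1 | (r < s)%N) (x s * q ^+ y s - x r * q ^+ y r)) =
  (\prod_(r < l.+1) \prod_(s < l.+1 | (r < s)%N) (x s * q ^+ j s - x r * q ^+ j r)) *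
  ((-1) ^+ (weight y - weight j) * q ^+ 'C(weight y - weight j, 2)) *
  \prod_s \prod_r \prod_((j r).+1 <= t < (y r).+1) (x s * q ^+ j s - x r * q ^+ t).
Proof.
move=> jy; rewrite weightB// bin2_sum_pairs exprD !expr_sum.
rewrite (big_ord_pairs _ (fun s r => \prod_(j r <= t < y r) (x s * q ^+ y s - x r * q ^+ t)))/=.
rewrite (big_ord_pairs _ (fun s r => \prod_((j r).+1 <= t < (y r).+1) (x s * q ^+ j s - x r * q ^+ t)))/=.
(* The ranges are moved to start at 0 or 1, with [v * q ^+ a] as the new base node, to match the two
   lemmas on diagonal and paired factors. *)
have below u v a b : \prod_(a <= t < b) (u - v * q ^+ t) =
    \prod_(0 <= t < b - a) (u - v * q ^+ a * q ^+ t).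
  rewrite -{1}(add0n a) big_addn; apply: eq_bigr => t _.
  by rewrite addnC exprD mulrA.
have above u v a b : (a <= b)%N -> \prod_(a.+1 <= t < b.+1) (u - v * q ^+ t) =
    \prod_(1 <= t < (b - a).+1) (u - v * q ^+ a * q ^+ t).
  move=> ab; rewrite -{1}(add1n a) big_addn subSn//; apply: eq_bigr => t _.
  by rewrite addnC exprD mulrA.
have top r : x r * q ^+ y r = x r * q ^+ j r * q ^+ (y r - j r).
  by rewrite -mulrA -exprD subnKC.
have diag (r : 'I_l.+1) : \prod_(j r <= t < y r) (x r * q ^+ y r - x r * q ^+ t) =
    (-1) ^+ (y r - j r) * q ^+ 'C(y r - j r, 2) *
    \prod_((j r).+1 <= t < (y r).+1) (x r * q ^+ j r - x r * q ^+ t).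
  by rewrite below above// top prod_qnodes_diag.
have pair (r s : 'I_l.+1) :
    (\prod_(j s <= t < y s) (x r * q ^+ y r - x s * q ^+ t) *
     \prod_(j r <= t < y r) (x s * q ^+ y s - x r * q ^+ t)) *
    (x s * q ^+ y s - x r * q ^+ y r) =
    (x s * q ^+ j s - x r * q ^+ j r) * q ^+ ((y r - j r) * (y s - j s)) *
    (\prod_((j s).+1 <= t < (y s).+1) (x r * q ^+ j r - x s * q ^+ t) *
     \prod_((j r).+1 <= t < (y r).+1) (x s * q ^+ j s - x r * q ^+ t)).
  rewrite (below _ (x s)) (below _ (x r)) (above _ (x s))// (above _ (x r))// !top [X in X * _ = _]mulrC prod_qnodes_pair.
  by rewrite [((y r - j r) * _)%N]mulnC -!mulrA [X in _ * (_ * X) = _]mulrC.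
under [X in X * _ * _ = _]eq_bigr do rewrite diag.
rewrite !big_split/=.
have -> : \prod_(r < l.+1) q ^+ (\sum_(s < l.+1 | (r < s)%N)
    (y r - j r) * (y s - j s)) =
   \prod_(r < l.+1) \prod_(s < l.+1 | (r < s)%N) q ^+ ((y r - j r) * (y s - j s)).
  by apply: eq_bigr => r _; rewrite expr_sum.
set P1 := \prod_(r < l.+1) \prod_(s < l.+1 | _) (\prod_(_ <= _ < _) _ * _).
set P2 := \prod_(r < l.+1) \prod_(s < l.+1 | _) (_ - _).
set P3 := \prod_(r < l.+1) \prod_(s < l.+1 | _) (_ - _).
set P4 := \prod_(r < l.+1) \prod_(s < l.+1 | _) _ ^+ _.
set P5 := \prod_(r < l.+1) \prod_(s < l.+1 | _) (_ * _).
have e : P1 * P2 = P3 * P4 * P5.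
  rewrite /P1 /P2 /P3 /P4 /P5 -!big_split/=; apply: eq_bigr => r _.
  rewrite -!big_split/=; apply: eq_bigr => s _; exact: pair.
rewrite -[LHS]mulrA e; ring.
Qed.

(** The nodes above [y] give [mixed_qpoch q x i y]. Those below give [mixed_qpoch q x y j] after
    [prod_qnodes_below], which absorbs one of the two Vandermonde products arising from the nodes at
    [y]; the other one remains on the right. *)
Lemma node_complement_mixed i j y : (forall k, j k <= y k <= i k)%N ->
  node_complement i j y (fun s r t => x s * q ^+ y s - x r * q ^+ t) =
  (\prod_(r < l.+1) \prod_(s < l.+1 | (r < s)%N)
      (- (x s * q ^+ j s - x r * q ^+ j r))) *
  (\prod_s (x s * q ^+ j s)) ^+ (weight i - weight j) *
  (\prod_(r < l.+1) \prod_(s < l.+1 | (r < s)%N)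
      (x s * q ^+ y s - x r * q ^+ y r)) *
  ((-1) ^+ (weight y - weight j) *
   q ^+ ('C(weight y - weight j, 2) +
         (weight y - weight j) * (weight i - weight y))) *
  mixed_qpoch q x i y * mixed_qpoch q x y j.
Proof.
move=> jyi.
have jy k : (j k <= y k)%N by have /andP[] := jyi k.
have yi k : (y k <= i k)%N by have /andP[] := jyi k.
have wjy := weight_le jy; have wyi := weight_le yi.
rewrite !mixed_qpochE// node_complementE//.
have -> : \prod_(r < l.+1) \prod_(s < l.+1 | (r < s)%N)
    ((x s * q ^+ y s - x r * q ^+ y r) * (x r * q ^+ y r - x s * q ^+ y s)) =
  (\prod_(r < l.+1) \prod_(s < l.+1 | (r < s)%N) (x s * q ^+ y s - x r * q ^+ y r))
  * ((\prod_(r < l.+1) \prod_(s < l.+1 | (r < s)%N) (-1)) *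
  (\prod_(r < l.+1) \prod_(s < l.+1 | (r < s)%N) (x s * q ^+ y s - x r * q ^+ y r))).
  rewrite -!big_split/=; apply: eq_bigr => r _; rewrite -!big_split/=.
  by apply: eq_bigr => s _; ring.
have -> : \prod_(r < l.+1) \prod_(s < l.+1 | (r < s)%N)
      (- (x s * q ^+ j s - x r * q ^+ j r)) =
  (\prod_(r < l.+1) \prod_(s < l.+1 | (r < s)%N) (-1)) *
  (\prod_(r < l.+1) \prod_(s < l.+1 | (r < s)%N) (x s * q ^+ j s - x r * q ^+ j r)).
  rewrite -!big_split/=; apply: eq_bigr => r _; rewrite -!big_split/=.
  by apply: eq_bigr => s _; ring.
have below := prod_qnodes_below jy.
(* This change of base, raised to the power [weight i - weight y], is the source of the cross term
   in the exponent of [q]. *)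
have zX : \prod_s (x s * q ^+ y s) =
    \prod_s (x s * q ^+ j s) * q ^+ (weight y - weight j).
  rewrite weightB// expr_sum -big_split/=; apply: eq_bigr => s _.
  by rewrite -mulrA -exprD subnKC.
have X0 : \prod_s (x s * q ^+ j s) != 0.
  by apply/prodf_neq0 => s _; rewrite mulf_neq0 ?expf_neq0.
rewrite zX; move: below X0.
set n := (weight i - weight j)%N; set m := (weight y - weight j)%N.
have -> : (weight i - weight y = n - m)%N by rewrite /n /m; lia.
have mn : (m <= n)%N by rewrite /n /m; lia.
set A := \prod_s \prod_r \prod_(j r <= t < y r) _.
set Dz := \prod_(r < l.+1) \prod_(s < l.+1 | _) (x s * q ^+ y s - _).
set DX := \prod_(r < l.+1) \prod_(s < l.+1 | _) (x s * q ^+ j s - _).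
set C := \prod_s \prod_r \prod_(_ <= _ < (y r).+1) _.
set B := \prod_s \prod_r \prod_(_ <= _ < (i r).+1) _.
set X := \prod_s (x s * q ^+ j s) => below X0.
set eps := \prod_(r < l.+1) \prod_(s < l.+1 | _) (-1).
transitivity (A * Dz * B * eps * Dz); first by ring.
have -> : X ^+ n = X ^+ (n - m) * X ^+ m by rewrite -exprD subnK.
rewrite below exprD exprM exprMn; field.
by rewrite !expf_neq0.
Qed.
End QNodes.

Lemma bin2D (m n : nat) : 'C(m + n, 2) = ('C(m, 2) + m * n + 'C(n, 2))%N.
Proof. by elim: m => [|m IH]; rewrite ?add0n// addSn !binS !bin1 IH; lia. Qed.

Lemma signed_qpowE (K : fieldType) (q : K) (l : nat) (i j : multiindex l) :
  (weight j <= weight i)%N ->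
  signed_qpow q i j =
  (-1) ^+ (weight i - weight j) * q ^+ 'C(weight i - weight j, 2).
Proof.
move=> ji; rewrite /signed_qpow subzn//; set d := (_ - _)%N.
have -> : ((d%:Z * (d%:Z - 1)) %/ 2)%Z = 'C(d, 2)%:Z.
  have -> : d%:Z * (d%:Z - 1) = 'C(d, 2)%:Z * 2.
    by have := sqrn_bin2 d; lia.
  by rewrite mulzK.
by rewrite -!exprnP.
Qed.

Lemma mixed_qpochV (K : fieldType) (q : K) (l : nat) (x : 'I_l.+1 -> K)
    (i j : multiindex l) :
  \prod_r \prod_s (qpoch q (q * (x r / x s) * q ^ ((j r)%:Z - (j s)%:Z))
    ((i r)%:Z - (j r)%:Z))^-1 = (mixed_qpoch q x i j)^-1.
Proof. by rewrite -prodfV; apply: eq_bigr => r _; rewrite -prodfV. Qed.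

Section DistinctQNodes.
Variables (K : fieldType) (q : K) (l : nat) (x : 'I_l.+1 -> K).
Hypotheses (q0 : q != 0) (q1 : forall k, q ^+ k.+1 != 1).
Hypotheses (x0 : forall r, x r != 0).
Hypothesis qx0 : forall (i j : multiindex l) (r s : 'I_l.+1),
  r != s -> (j r <= i r)%N ->
  qpoch q (q * (x r / x s) * q ^ ((j r)%:Z - (j s)%:Z)) ((i r)%:Z - (j r)%:Z) != 0.
Implicit Types i j y : multiindex l.

Lemma expr_q_inj (m n : nat) : q ^+ m = q ^+ n -> m = n.
Proof.
wlog mn : m n / (m <= n)%N => [th|].
  by case: (leqP m n) => [/th//|/ltnW/th th' /esym/th' ->].
rewrite -(subnKC mn) exprD -{1}[q ^+ m]mulr1 => /(mulfI (expf_neq0 _ q0))/esym.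
by case: (n - m)%N => [|k /eqP]; [rewrite addn0|rewrite (negPf (q1 k))].
Qed.

(** For [r = s], [q] is not a root of unity. For [r != s], the difference of the nodes is, up to a
    nonzero factor, a Pochhammer symbol of length 1, hence nonzero by [qx0]. *)
Lemma qnodes_distinct (r s : 'I_l.+1) (t t' : nat) :
  (r != s) || (t != t') -> x r * q ^+ t != x s * q ^+ t'.
Proof.
have [-> /= tt'|rs _] := eqVneq r s.
  by rewrite (inj_eq (mulfI (x0 s))); apply: contraNneq tt' => /expr_q_inj ->.
(* The choice [i r = t.+1], [j r = t] leaves a single factor, and [j s = t'.+1] compensates the
   extra [q] in its argument. *)
have := @qx0 (fun k => if k == r then t.+1 else 0%N)
  (fun k => if k == r then t else t'.+1) r s rs.
have sr : (s == r) = false by rewrite eq_sym (negPf rs).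
rewrite /= eqxx sr qpoch_homogeneous// => /(_ (leqnSn t)).
rewrite mulf_eq0 negb_or => /andP[_]; rewrite big_ltn// big_geq// mulr1.
by apply: contraNneq => e; rewrite !exprS !mulrA ![_ * q]mulrC -!mulrA e subrr.
Qed.

Lemma mixed_qpoch_node_complement i j y : (forall k, j k <= y k <= i k)%N ->
  (mixed_qpoch q x i y)^-1 * (mixed_qpoch q x y j)^-1 =
  (\prod_(r < l.+1) \prod_(s < l.+1 | (r < s)%N)
      (- (x s * q ^+ j s - x r * q ^+ j r))) *
  (\prod_s (x s * q ^+ j s)) ^+ (weight i - weight j) *
  ((-1) ^+ (weight y - weight j) *
   q ^+ ('C(weight y - weight j, 2) +
         (weight y - weight j) * (weight i - weight y))) *
  (\prod_(r < l.+1) \prod_(s < l.+1 | (r < s)%N)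
      (x s * q ^+ y s - x r * q ^+ y r)) /
  node_complement i j y (fun s r t => x s * q ^+ y s - x r * q ^+ t).
Proof.
move=> jyi; have NC := node_complement_mixed q0 x0 jyi.
have NC0 : node_complement i j y (fun s r t => x s * q ^+ y s - x r * q ^+ t) != 0.
  apply/prodf_neq0 => s _; apply/prodf_neq0 => r _; rewrite prodf_seq_neq0.
  apply/allP => t _; apply/implyP => ne; rewrite subr_eq0 eq_sym.
  exact: qnodes_distinct.
(* As the whole product is nonzero, so is each of its factors, in particular both [mixed_qpoch]
   terms. *)
move: NC0; rewrite NC !mulf_eq0 !negb_or => /andP[/andP[/andP[/andP[/andP[n1 n2] n3] n4] n5] n6].
move: n1 n2 n3 n4 n5 n6.
set c := \prod_(r < l.+1) \prod_(s < l.+1 | _) (- _).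
set X := _ ^+ (weight i - weight j).
set D := \prod_(r < l.+1) \prod_(s < l.+1 | _) (_ - _).
set e := _ ^+ _ * _ ^+ _ => n1 n2 n3 n4 n5 n6.
field.
by rewrite n1 n2 n3 n5 n6 /e mulf_eq0 negb_or n4.
Qed.
End DistinctQNodes.

Lemma size_prod_linear_leq (K : fieldType) (c : nat -> K) (m n : nat) :
  (size (\prod_(m <= t < n) (1 - c t *: 'X) : {poly K})%R <= (n - m).+1)%N.
Proof.
elim: n => [|n IH]; first by rewrite big_geq// size_poly1.
have [mn|nm] := leqP m n; last first.
  by rewrite big_geq// size_poly1.
rewrite big_nat_recr//= subSn//.
apply: (leq_trans (size_polyMleq _ _)).
have sz2 : (size (1 - c n *: 'X : {poly K})%R <= 2)%N.
  rewrite (leq_trans (size_polyD _ _))// geq_max size_poly1 size_polyN/=.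
  by rewrite (leq_trans (size_scale_leq _ _))// size_polyX.
by rewrite -subn1 leq_subLR (leq_trans (leq_add IH sz2))// addn2 add1n.
Qed.

(** * The case A_l *)

Section CaseA.
Variables (K : fieldType) (q : K) (l : nat) (a : K) (x : 'I_l.+1 -> K).
Hypotheses (q0 : q != 0) (q1 : forall k, q ^+ k.+1 != 1).
Hypothesis dA : denominators_neq0_A q a x.
Implicit Types i j y : multiindex l.

Lemma qpoch_aq_neq0 k n : qpoch q (a * q * (x k / x ord_max)) n%:Z != 0.
Proof.
have [_ _ + _] := dA => /(_ (fun _ => n) (fun _ => 0%N) k).
by rewrite /weight big1// addr0.
Qed.

(** The quotient of the two Pochhammer symbols containing [a], as a polynomial in the node. When
    [weight j < weight i] its degree is at most [weight i - weight j - 1], just within the bound of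
    [sum_box_lagrange]. *)
Definition quotient_poly i j : {poly K} :=
  \prod_(weight j <= t < (weight i).-1) (1 - (a * q ^+ t.+1 / x ord_max) *: 'X).

Lemma qpoch_quotient i j k (m : nat) : (weight j < weight i)%N ->
  qpoch q (a * q * (x k / x ord_max)) (m%:Z + (weight i)%:Z - 1) /
  qpoch q (a * q * (x k / x ord_max)) (m%:Z + (weight j)%:Z) =
  (quotient_poly i j).[x k * q ^+ m].
Proof.
move=> ji; rewrite -PoszD; have := qpoch_aq_neq0 k (m + weight j).
(* Since [weight i] is positive, the index is a natural number and the branch [Negz] of [qpoch] does
   not occur. *)
have -> : (m%:Z + (weight i)%:Z - 1) = (m + (weight i).-1)%N%:Z by lia.
rewrite /= (big_cat_nat (n := m + weight j) (p := m + (weight i).-1))//=; last by lia.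
move=> d0; rewrite mulrAC divff// mul1r horner_prod addnC big_addn addKn.
apply: eq_bigr => t _.
by rewrite !hornerE/= exprS exprD; ring.
Qed.

Lemma MAstar_MA_box i j : (forall k, j k <= i k)%N -> (weight j < weight i)%N ->
  matprod (MAstar q a x) (MA q a x) i j = 0.
Proof.
move=> ji wji; have [x0 qx0 _ _] := dA.
(* The part of each summand independent of [y]: the linear factors of [MAstar], the constants of
   [mixed_qpoch_node_complement], and the total sign and power of [q]. *)
pose c := \prod_k (1 - a * (x k / x ord_max) * q ^+ (i k + weight i)) *
  (\prod_(r < l.+1) \prod_(s < l.+1 | (r < s)%N)
      (- (x s * q ^+ j s - x r * q ^+ j r))) *
  (\prod_s (x s * q ^+ j s)) ^+ (weight i - weight j) *
  ((-1) ^+ (weight i - weight j) * q ^+ 'C(weight i - weight j, 2)).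
have szh : (size (quotient_poly i j) <= \sum_r (i r - j r))%N.
  by rewrite -weightB// (leq_trans (size_prod_linear_leq _ _ _))//; lia.
have := @sum_box_lagrange K l (weight i).+1 i j (fun s t => x s * q ^+ t)
  (quotient_poly i j) _ szh _.
move=> th; rewrite /matprod -[RHS](mulr0 c) -[X in _ = c * X]th; first last.
- by move=> *; apply: (qnodes_distinct q0 q1).
- by move=> r; rewrite ji ltnS /weight (bigD1 r)//= leq_addr.
rewrite big_distrr/=; apply: eq_bigr => y /forallP jyi.
set Y : multiindex l := fun k => y k.
have jy k : (j k <= Y k)%N by have /andP[] := jyi k.
have yi k : (Y k <= i k)%N by have /andP[] := jyi k.
have wjy := weight_le jy; have wyi := weight_le yi.
rewrite /MAstar /MA !mixed_qpochV signed_qpowE//.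
have -> : \prod_s (quotient_poly i j).[x s * q ^+ y s] =
    \prod_k qpoch q (a * q * (x k / x ord_max)) ((Y k)%:Z + (weight i)%:Z - 1) *
    \prod_k (qpoch q (a * q * (x k / x ord_max)) ((Y k)%:Z + (weight j)%:Z))^-1.
  by rewrite -big_split/=; apply: eq_bigr => s _; rewrite qpoch_quotient.
have := @mixed_qpoch_node_complement _ _ _ _ q0 q1 x0 qx0 i j Y jyi.
rewrite /c.
(* The exponent from the node complement and the one from [signed_qpow q i Y] add up to a quantity
   free of [y]; likewise for the signs below. *)
have -> : 'C(weight i - weight j, 2) =
   ('C(weight Y - weight j, 2) +
    (weight Y - weight j) * (weight i - weight Y) +
    'C(weight i - weight Y, 2))%N.
  by rewrite -bin2D; congr 'C(_, _); lia.
have -> : (-1) ^+ (weight i - weight j) =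
   (-1) ^+ (weight Y - weight j) *
   (-1) ^+ (weight i - weight Y) :> K.
  by rewrite -exprD; congr (_ ^+ _); lia.
rewrite [q ^+ (_ + 'C(weight i - _, 2))]exprD.
set Ei := (mixed_qpoch q x i _)^-1; set Ej := (mixed_qpoch q x _ j)^-1.
move=> E; set P1 := \prod_k _; set P2 := \prod_k _; set P3 := \prod_k _.
set s1 := (-1) ^+ (weight i - _); set s2 := q ^+ 'C(weight i - _, 2).
transitivity (P1 * P2 * P3 * (s1 * s2) * (Ei * Ej)); first by ring.
rewrite E; ring.
Qed.
End CaseA.

(** * Passing to the inverse *)

(** The finite type over which [matprod] sums depends on the row [i]; a bound common to all rows is
    needed to read it as a product of finite matrices. *)
Lemma sum_box_bound (K : fieldType) (l d d' : nat) (i j : multiindex l)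
    (F : multiindex l -> K) :
  (forall k, i k <= d)%N -> (forall k, i k <= d')%N ->
  \sum_(y : {ffun 'I_l.+1 -> 'I_d.+1} | [forall k, (j k <= y k <= i k)%N])
    F (fun k => y k : nat) =
  \sum_(y : {ffun 'I_l.+1 -> 'I_d'.+1} | [forall k, (j k <= y k <= i k)%N])
    F (fun k => y k : nat).
Proof.
move=> id id'.
rewrite (reindex_onto
  (fun y : {ffun 'I_l.+1 -> 'I_d'.+1} => [ffun k => inord (y k)])
  (fun y : {ffun 'I_l.+1 -> 'I_d.+1} => [ffun k => inord (y k)]))/=; last first.
  move=> y /forallP jyi; apply/ffunP => k; apply/val_inj; rewrite !ffunE/=.
  have /andP[_ yi] := jyi k.
  by rewrite inordK ?ltnS ?inordK// ?ltnS// (leq_trans yi).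
have inordE (y : {ffun 'I_l.+1 -> 'I_d'.+1}) : [forall k, (j k <= y k <= i k)%N] ->
    forall k, [ffun k => inord (y k) : 'I_d.+1] k = y k :> nat.
  by move=> /forallP jyi k; have /andP[_ yi] := jyi k;
    rewrite ffunE inordK// ltnS (leq_trans yi).
(* [inord] sends values out of range to 0; the round-trip condition rules this out. *)
have inord_stable (y : {ffun 'I_l.+1 -> 'I_d'.+1}) :
    [forall k, (j k <= [ffun k0 => inord (y k0) : 'I_d.+1] k <= i k)%N] ->
    [ffun k => inord ([ffun k0 => inord (y k0) : 'I_d.+1] k)] == y ->
    forall k, [ffun k0 => inord (y k0) : 'I_d.+1] k = y k :> nat.
  move=> /forallP jyi /eqP/ffunP yE k; have /andP[_ yi] := jyi k.
  by rewrite -[in RHS](yE k) [in RHS]ffunE inordK// ltnS (leq_trans yi).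
apply: eq_big => [y|y /andP[jyi yE]].
  apply/andP/idP => [[jyi yE]|jyi].
    by apply/forallP => k; rewrite -(inord_stable _ jyi yE); exact: (forallP jyi).
  split; first by apply/forallP => k; rewrite inordE//; exact: (forallP jyi).
  by apply/eqP/ffunP => k; apply/val_inj; rewrite ffunE inordE//= inord_val.
by congr F; apply: functional_extensionality => k; rewrite (inord_stable _ jyi yE).
Qed.

(* Triangularity for the componentwise order, which the summation range of
   [matprod] needs; it is stronger than [lower_triangular]. *)
Definition box_triangular (K : fieldType) (l : nat)
    (M : multiindex l -> multiindex l -> K) : Prop :=
  forall i j k, (i k < j k)%N -> M i j = 0.

Section Inverse.
Variables (K : fieldType) (l : nat) (M N : multiindex l -> multiindex l -> K).
Implicit Types i j : multiindex l.

Lemma box_triangularP : box_triangular M -> lower_triangular M.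
Proof. by move=> Mt i j [k [_ ijk]]; exact: Mt ijk. Qed.

Lemma le_weight k i : (i k <= weight i)%N.
Proof. by rewrite /weight (bigD1 k)//= leq_addr. Qed.

Lemma deltaE i j : delta K i j = [forall k, i k == j k]%:R.
Proof.
rewrite /delta; case: forallP => [ij|/forallP].
  by rewrite big1// => k _; rewrite ij.
by rewrite negb_forall => /existsP[k ij]; rewrite (bigD1 k)//= (negPf ij) mul0r.
Qed.

(** If [j <= i] fails in some component the range is empty; if [i = j] only [y = i] remains;
    otherwise the weights differ strictly, which is the case treated by interpolation. *)
Lemma matprod_eq_delta :
  (forall i, M i i * N i i = 1) ->
  (forall i j, (forall k, j k <= i k)%N -> (weight j < weight i)%N ->
     matprod M N i j = 0) ->
  forall i j, delta K i j = matprod M N i j.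
Proof.
move=> MN1 MN0 i j; rewrite deltaE.
case: (boolP [forall k, (j k <= i k)%N]) => [/forallP ji|]; last first.
  rewrite negb_forall => /existsP[k]; rewrite -ltnNge => ij.
  rewrite /matprod big_pred0; last first.
    move=> y; apply/forallP => /(_ k) /andP[/leq_trans h /h].
    by rewrite leqNgt ij.
  by case: forallP => // /(_ k)/eqP e; rewrite e ltnn in ij.
have [ij|] := boolP [forall k, i k == j k]; last first.
  rewrite negb_forall => /existsP[k ij]; rewrite MN0//.
  rewrite /weight (bigD1 k)//= [X in (_ < X)%N](bigD1 k)//=.
  by rewrite -addSn leq_add ?leq_sum// ltn_neqAle eq_sym ij ji.
have -> : j = i by apply: functional_extensionality => k; rewrite (eqP (forallP ij k)).
rewrite /matprod (big_pred1 [ffun k => inord (i k)]); last first.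
  move=> y /=; apply/forallP/eqP => [iyi|-> k].
    apply/ffunP => k; apply/val_inj; rewrite ffunE/= inordK ?ltnS ?le_weight//.
    by apply/eqP; rewrite eqn_leq andbC iyi.
  by rewrite ffunE inordK ?ltnS ?le_weight// leqnn.
have -> : (fun k => [ffun k => inord (i k) : 'I_(weight i).+1] k : nat) = i.
  by apply: functional_extensionality => k; rewrite ffunE inordK ?ltnS ?le_weight.
by rewrite MN1.
Qed.
End Inverse.

(** Triangularity kills the terms outside the box, so the sum may run over a whole cube that does
    not depend on [i] and [j]. *)
Lemma sum_box_triangular (K : fieldType) (l d : nat)
    (M N : multiindex l -> multiindex l -> K) (i j : multiindex l) :
  box_triangular M -> box_triangular N -> (forall k, i k <= d)%N ->
  matprod M N i j = \sum_(y : {ffun 'I_l.+1 -> 'I_d.+1})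
    M i (fun k => y k : nat) * N (fun k => y k : nat) j.
Proof.
move=> Mt Nt id; rewrite [RHS](bigID [pred y : {ffun 'I_l.+1 -> 'I_d.+1} |
  [forall k, (j k <= y k <= i k)%N]])/=.
rewrite [X in _ + X]big1 ?addr0.
  exact: (sum_box_bound j (fun y => M i y * N y j) (fun k => le_weight k i) id).
move=> y; rewrite negb_forall => /existsP[k]; rewrite negb_and -!ltnNge.
by case/orP => h; [rewrite (Nt _ _ k)// mulr0|rewrite (Mt _ _ k)// mul0r].
Qed.

Lemma inverse_box_triangular (K : fieldType) (l : nat)
    (M N : multiindex l -> multiindex l -> K) :
  box_triangular M -> box_triangular N ->
  (forall i j, delta K i j = matprod M N i j) ->
  forall i j, delta K i j = matprod N M i j.
Proof.
(* With this [d] the cube of multi-indices with entries at most [d] contains both [i] and [j]; on it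
   [M] and [N] become square matrices, to which [mulmx1C] applies. *)
move=> Mt Nt MN i j; pose d := (weight i + weight j)%N.
pose T := {ffun 'I_l.+1 -> 'I_d.+1}.
pose mi (u : 'I_#|{: T}|) : multiindex l := fun k => (enum_val u : T) k.
pose mx (P : multiindex l -> multiindex l -> K) :=
  \matrix_(u < #|{: T}|, v < #|{: T}|) P (mi u) (mi v).
have mi_le u k : (mi u k <= d)%N by rewrite /mi -ltnS.
have mxM P Q : box_triangular P -> box_triangular Q ->
    forall u v, (mx P *m mx Q) u v = matprod P Q (mi u) (mi v).
  move=> Pt Qt u v; rewrite (@sum_box_triangular _ _ d)// mxE.
  rewrite [RHS](reindex (fun u : 'I_#|{: T}| => enum_val u : T))/=; last first.
    exact/onW_bij/enum_val_bij.
  by apply: eq_bigr => w _; rewrite !mxE.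
have mx1 : mx M *m mx N = 1%:M.
  apply/matrixP => u v; rewrite mxM// -MN deltaE mxE; congr (_ *+ nat_of_bool _).
  apply/forallP/eqP => [uv|->//].
  by apply/enum_val_inj/ffunP => k; apply/val_inj/eqP; exact: uv.
pose idx (y : multiindex l) : 'I_#|{: T}| := enum_rank ([ffun k => inord (y k)] : T).
have idxK (y : multiindex l) : (forall k, y k <= d)%N -> mi (idx y) = y.
  move=> yd; apply: functional_extensionality => k.
  by rewrite /mi enum_rankK ffunE inordK// ltnS.
have ki : mi (idx i) = i.
  by apply: idxK => k; rewrite (leq_trans (le_weight k i))// leq_addr.
have kj : mi (idx j) = j.
  by apply: idxK => k; rewrite (leq_trans (le_weight k j))// leq_addl.
rewrite -{2}ki -{2}kj -mxM// (mulmx1C mx1) -mx1 mxM// -MN.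
by rewrite ki kj.
Qed.

(** The convention [0^-1 = 0] acts twice: the symbol with [r = s = k] has negative index and
    contains [(1 - q * q^-1)^-1 = 0], so the product vanishes, and then so does its inverse. *)
Lemma mixed_qpochV_eq0 (K : fieldType) (q : K) (l : nat) (x : 'I_l.+1 -> K)
    (i j : multiindex l) (k : 'I_l.+1) :
  q != 0 -> x k != 0 -> (i k < j k)%N -> (mixed_qpoch q x i j)^-1 = 0.
Proof.
move=> q0 xk0 ij; apply/eqP; rewrite invr_eq0; apply/eqP.
rewrite /mixed_qpoch (bigD1 k)//= [X in X * _](bigD1 k)//= divff// mulr1 subrr.
rewrite expr0z mulr1.
have -> : (i k)%:Z - (j k)%:Z = Negz (j k - i k).-1 by lia.
by rewrite /= big_ltn// expr1 divff// subrr invr0 !mul0r.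
Qed.

Lemma mixed_qpoch_diag (K : fieldType) (q : K) (l : nat) (x : 'I_l.+1 -> K)
    (i : multiindex l) : mixed_qpoch q x i i = 1.
Proof.
by apply: big1 => r _; apply: big1 => s _; rewrite subrr/= big_geq.
Qed.

(** * The inverse pair for A_l *)

Section InverseA.
Variables (K : fieldType) (q : K) (l : nat) (a : K) (x : 'I_l.+1 -> K).
Hypotheses (q0 : q != 0) (q1 : forall k, q ^+ k.+1 != 1).
Hypothesis dA : denominators_neq0_A q a x.

Lemma MAstar_MA_diag i : MAstar q a x i i * MA q a x i i = 1.
Proof.
have [_ _ _ a0] := dA.
rewrite /MAstar /MA !mixed_qpochV mixed_qpoch_diag invr1 mulr1 mul1r.
rewrite signed_qpowE// subnn expr0 mulr1 mulr1 -!big_split/= big1// => k _.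
rewrite -PoszD; have := qpoch_aq_neq0 dA k (i k + weight i).
(* At 0 the symbol of index -1 is the inverse of the linear factor [1 - a * (x k / x ord_max)].
   Otherwise the linear factor is the last factor of the longer Pochhammer symbol. *)
case: (i k + weight i)%N => [_|n].
  rewrite /= big_nil invr1 mulr1 big_ltn// big_geq// !mulr1.
  rewrite expr1 (_ : a * q * _ / q = a * (x k / x ord_max)) ?divff//.
  by case: dA => x0 _ _ _; field; rewrite q0 x0.
have -> : n.+1%:Z - 1 = n by lia.
rewrite /= big_nat_recr//= => h.
have -> : a * (x k / x ord_max) * q ^+ n.+1 = a * q * (x k / x ord_max) * q ^+ n.
  by rewrite exprS; ring.
by rewrite [X in X / _]mulrC divff.
Qed.

Lemma inverse_lower_triangular_A :
  inverse_lower_triangular (MA q a x) (MAstar q a x).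
Proof.
have [x0 _ _ _] := dA.
have Mt : box_triangular (MA q a x).
  by move=> i j k ij; rewrite /MA mixed_qpochV (mixed_qpochV_eq0 q0 (x0 k) ij) mul0r.
have Nt : box_triangular (MAstar q a x).
  move=> i j k ij.
  by rewrite /MAstar mixed_qpochV (mixed_qpochV_eq0 q0 (x0 k) ij) mulr0 mul0r.
have NM := matprod_eq_delta MAstar_MA_diag (MAstar_MA_box q0 q1 dA).
split=> //; try exact: box_triangularP.
exact: (inverse_box_triangular Nt Mt NM).
Qed.
End InverseA.

(** * The case C_l *)

Lemma node_complementM (K : fieldType) (l : nat) (i j y : multiindex l)
    (f g : 'I_l.+1 -> 'I_l.+1 -> nat -> K) :
  node_complement i j y (fun s r t => f s r t * g s r t) =
  node_complement i j y f * node_complement i j y g.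
Proof.
rewrite -big_split/=; apply: eq_bigr => s _; rewrite -big_split/=.
by apply: eq_bigr => r _; rewrite -big_split.
Qed.

(** Restoring the omitted node [(s, y s)] makes the ranges independent of [y], which allows monomial
    factors to be evaluated. *)
Lemma node_complement_all (K : fieldType) (l : nat) (i j y : multiindex l)
    (f : 'I_l.+1 -> 'I_l.+1 -> nat -> K) :
  (forall r, j r <= y r <= i r)%N ->
  node_complement i j y f * \prod_s f s s (y s) =
  \prod_s \prod_r \prod_(j r <= t < (i r).+1) f s r t.
Proof.
move=> jyi; rewrite -big_split/=; apply: eq_bigr => s _.
rewrite (bigD1 s)//= [RHS](bigD1 s)//= mulrAC; congr (_ * _); last first.
  by apply: eq_bigr => r rs; apply: eq_bigl => t; rewrite rs.
rewrite [RHS](bigD1_seq (y s))/= ?iota_uniq// 1?mulrC ?mem_index_iota ?ltnS//.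
by congr (_ * _); apply: eq_bigl => t; rewrite eqxx.
Qed.

(** Each [z s] occurs in [l] pairs; multiplying by the diagonal product completes the pairs to all
    [(r, s)]. *)
Lemma prod_pairs_mul (K : fieldType) (l : nat) (z : 'I_l.+1 -> K) :
  (forall r, z r != 0) ->
  \prod_(r < l.+1) \prod_(s < l.+1 | (r < s)%N) (z s * z r) = (\prod_s z s) ^+ l.
Proof.
move=> z0.
have Z0 : \prod_s z s != 0 by apply/prodf_neq0.
apply: (mulfI Z0); rewrite -exprS -prodrXl.
have -> : \prod_r z r ^+ l.+1 = \prod_(r < l.+1) \prod_(s < l.+1) z r.
  by apply: eq_bigr => r _; rewrite prodr_const card_ord.
rewrite (big_ord_pairs _ (fun r s => z r))/=; congr (_ * _).
by apply: eq_bigr => r _; apply: eq_bigr => s _; rewrite mulrC.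
Qed.

Section CaseC.
Variables (K : fieldType) (q : K) (l : nat) (x : 'I_l.+1 -> K).
Hypotheses (q0 : q != 0) (q1 : forall k, q ^+ k.+1 != 1).
Hypothesis dC : denominators_neq0_C q x.
Implicit Types i j y : multiindex l.

Let z i s := x s * q ^+ i s.

(** In [MC q x i y] and [MCstar q x y j] the base points become the same nodes [z y s], with
    [t > y r] in the former and [t < y r] in the latter, so that together they fill the node
    complement except at [t = y r]. *)
Lemma MC_E i j : (forall k, j k <= i k)%N ->
  MC q x i j = (mixed_qpoch q x i j)^-1 *
    (\prod_s \prod_r \prod_((j r).+1 <= t < (i r).+1)
       (1 - z j s * (x r * q ^+ t)))^-1.
Proof.
move=> ji; rewrite /MC; under eq_bigr do rewrite big_split/=.
rewrite big_split/= mixed_qpochV; congr (_ * _).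
rewrite [X in _ = X^-1]exchange_big/= -prodfV; apply: eq_bigr => r _.
rewrite -prodfV; apply: eq_bigr => s _; congr (_^-1).
rewrite qpoch_subn// -{1}(add0n (j r).+1) big_addn subSS.
by apply: eq_bigr => t _; rewrite /z addnS exprS !exprD; ring.
Qed.

Lemma MCstar_E i j : (forall k, j k <= i k)%N ->
  MCstar q x i j = (mixed_qpoch q x i j)^-1 *
    (\prod_s \prod_r \prod_(j r <= t < i r) (1 - z i s * (x r * q ^+ t)))^-1 *
    ((\prod_(r < l.+1) \prod_(s < l.+1 | (r < s)%N) (1 - z j s * z j r)) /
     (\prod_(r < l.+1) \prod_(s < l.+1 | (r < s)%N) (1 - z i s * z i r))) *
    signed_qpow q i j.
Proof.
move=> ji; rewrite /MCstar; under eq_bigr do rewrite big_split/=.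
rewrite big_split/= mixed_qpochV; congr (_ * _ * _ * _).
  rewrite [X in _ = X^-1]exchange_big/= -prodfV; apply: eq_bigr => r _.
  rewrite -prodfV; apply: eq_bigr => s _; congr (_^-1).
  rewrite qpoch_subn// -[in RHS](add0n (j r)) big_addn.
  by apply: eq_bigr => t _; rewrite /z !exprD; ring.
rewrite -prodf_div; apply: eq_bigr => r _; rewrite -prodf_div.
by apply: eq_bigr => s _; rewrite /z !exprD; congr (_ / _); ring.
Qed.

Let x0 r : x r != 0. Proof. by have [] := dC. Qed.

Let z0 i s : z i s != 0. Proof. by rewrite mulf_neq0 ?expf_neq0. Qed.

(** For [r = s] this is the first factor of a Pochhammer symbol in [MCstar] with [i r = t + t'] and
    [j r = 0], which is nonempty because [t != t']. For [r != s] it is one of the pair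
    denominators. *)
Lemma one_sub_qnodes_neq0 (r s : 'I_l.+1) (t t' : nat) :
  (r != s) || (t != t') -> 1 - x r * q ^+ t * (x s * q ^+ t') != 0.
Proof.
have -> : x r * q ^+ t * (x s * q ^+ t') = x r * x s * q ^+ (t + t').
  by rewrite exprD; ring.
have [_ _ _ h4 h5] := dC.
have [<- /= tt'|rs _] := eqVneq r s.
  have := h4 (fun _ => t + t')%N (fun _ => 0%N) r r isT.
  rewrite qpoch_subn// subn0 add0n big_ltn; last by lia.
  by rewrite expr0 mulr1 mulf_eq0 negb_or => /andP[].
wlog rs' : r s t t' rs / (r < s)%N.
  move=> th; case: (ltngtP r s) => [h|h|/val_inj e]; first exact: th.
    by rewrite [x r * _]mulrC addnC; apply: th => //; rewrite eq_sym.
  by rewrite e eqxx in rs.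
have sr : (s == r) = false by rewrite eq_sym (negPf rs).
have := h5 (fun k => if k == r then t else t') r s rs'.
by rewrite /= eqxx sr.
Qed.

(* [z + 1 / z] is the variable in which the denominators of the C_l entries factor
   linearly: its differences are [(z - w) (1 - z w) / (- z w)]. *)
Let N (s : 'I_l.+1) (t : nat) := x s * q ^+ t + (x s * q ^+ t)^-1.

Lemma qnode_invB r s t t' : N r t - N s t' =
  (x r * q ^+ t - x s * q ^+ t') * (1 - x r * q ^+ t * (x s * q ^+ t')) *
  (- (x r * q ^+ t * (x s * q ^+ t'))^-1).
Proof. by rewrite /N; field; rewrite !x0 !expf_neq0. Qed.

Lemma MC_MCstar_box i j : (forall k, j k <= i k)%N -> (weight j < weight i)%N ->
  matprod (MC q x) (MCstar q x) i j = 0.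
Proof.
move=> ji wji; have [_ qx0 _ _ _] := dC.
(* [eps] and [kappa] gather the signs and monomials by which differences of the [N s t] deviate from
   the products [(z - w) * (1 - z * w)]. *)
pose eps : K := \prod_(r < l.+1) \prod_(s < l.+1 | (r < s)%N) (-1).
pose kappa := \prod_r \prod_(j r <= t < (i r).+1) (- (x r * q ^+ t)^-1).
pose X := \prod_s (z j s).
pose n := (weight i - weight j)%N.
pose c := (\prod_(r < l.+1) \prod_(s < l.+1 | (r < s)%N) (- (z j s - z j r))) *
  X ^+ n * (\prod_(r < l.+1) \prod_(s < l.+1 | (r < s)%N) (1 - z j s * z j r)) *
  (kappa ^+ l.+1 * (-1) ^+ l.+1) / (eps * X ^+ n.-1).
have th := @sum_box_lagrange K l (weight i).+1 i j N 1 _ _ _.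
rewrite /matprod -[RHS](mulr0 c) -[X in _ = c * X]th; first last.
- move=> r s t t' _ _ ne; rewrite -subr_eq0 qnode_invB !mulf_neq0//.
  + by rewrite subr_eq0; apply: (qnodes_distinct q0 q1).
  + exact: one_sub_qnodes_neq0.
  by rewrite oppr_eq0 invr_eq0 !mulf_neq0 ?expf_neq0.
- by rewrite size_poly1 -weightB// subn_gt0.
- by move=> r; rewrite ji ltnS le_weight.
rewrite big_distrr/=; apply: eq_bigr => y /forallP jyi.
set Y : multiindex l := fun k => y k.
have jy k : (j k <= Y k)%N by have /andP[] := jyi k.
have yi k : (Y k <= i k)%N by have /andP[] := jyi k.
have wjy := weight_le jy; have wyi := weight_le yi.
rewrite big1 ?mul1r; last by move=> s _; rewrite hornerC.
rewrite MC_E// MCstar_E// signed_qpowE//.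
have E := @mixed_qpoch_node_complement _ _ _ _ q0 q1 x0 qx0 i j Y jyi.
pose Z := \prod_s z Y s.
have eqeps (f : 'I_l.+1 -> 'I_l.+1 -> K) :
    \prod_(r < l.+1) \prod_(s < l.+1 | (r < s)%N) - f r s =
    eps * \prod_(r < l.+1) \prod_(s < l.+1 | (r < s)%N) f r s.
  rewrite -big_split/=; apply: eq_bigr => r _; rewrite -big_split/=.
  by apply: eq_bigr => s _; rewrite mulN1r.
have vander : \prod_(r < l.+1) \prod_(s < l.+1 | (r < s)%N)
      (N s (y s) - N r (y r)) =
   (\prod_(r < l.+1) \prod_(s < l.+1 | (r < s)%N) (z Y s - z Y r)) *
   (\prod_(r < l.+1) \prod_(s < l.+1 | (r < s)%N) (1 - z Y s * z Y r)) *
   (eps * Z ^- l).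
  rewrite -prod_pairs_mul// -prodfV.
  under [X in eps * X]eq_bigr do rewrite -prodfV.
  rewrite -eqeps -!big_split/=; apply: eq_bigr => r _; rewrite -!big_split/=.
  by apply: eq_bigr => s _; rewrite qnode_invB.
have nc : node_complement i j Y (fun s r t => N s (Y s) - N r t) =
    node_complement i j Y (fun s r t => x s * q ^+ Y s - x r * q ^+ t) *
    node_complement i j Y (fun s r t => 1 - z Y s * (x r * q ^+ t)) *
    node_complement i j Y (fun s r t => - (z Y s * (x r * q ^+ t))^-1).
  rewrite -!node_complementM; apply: eq_bigr => s _; apply: eq_bigr => r _.
  by apply: eq_bigr => t _; rewrite qnode_invB.
(* The pair factors appear squared: one copy cancels against the Vandermonde product in [N], the
   other is the denominator in [MCstar_E]. *)
have nc2 : node_complement i j Y (fun s r t => 1 - z Y s * (x r * q ^+ t)) =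
    (\prod_s \prod_r \prod_(j r <= t < Y r) (1 - z Y s * (x r * q ^+ t))) *
    (\prod_s \prod_r \prod_((Y r).+1 <= t < (i r).+1) (1 - z Y s * (x r * q ^+ t))) *
    (\prod_(r < l.+1) \prod_(s < l.+1 | (r < s)%N) (1 - z Y s * z Y r)) ^+ 2.
  rewrite node_complementE//; congr (_ * _).
  rewrite expr2 -big_split/=; apply: eq_bigr => r _.
  rewrite -big_split/=; apply: eq_bigr => s _.
  by rewrite -/(z Y r) -/(z Y s) [z Y r * _]mulrC.
have ZV p : Z ^- p = \prod_s (z Y s)^-1 ^+ p.
  by rewrite prodrXl prodfV exprVn.
(* The factor [(-1) ^+ l.+1 * Z ^- 2] supplies the omitted nodes, and [n + l.+1] is the total number
   of nodes. *)
have nc3 : node_complement i j Y (fun s r t => - (z Y s * (x r * q ^+ t))^-1) *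
    ((-1) ^+ l.+1 * Z ^- 2) = kappa ^+ l.+1 * Z ^- (n + l.+1).
  have -> : (-1) ^+ l.+1 * Z ^- 2 = \prod_s - (z Y s * (x s * q ^+ Y s))^-1.
    have -> : (-1) ^+ l.+1 = \prod_(s < l.+1) (-1) :> K.
      by rewrite prodr_const card_ord.
    rewrite ZV -big_split/=; apply: eq_bigr => s _.
    by rewrite mulN1r expr2 -invfM.
  have -> : kappa ^+ l.+1 = \prod_(s < l.+1) kappa.
    by rewrite prodr_const card_ord.
  rewrite node_complement_all// ZV -big_split/=; apply: eq_bigr => s _.
  have -> : (n + l.+1 = \sum_(r < l.+1) (i r - j r).+1)%N.
    under eq_bigr do rewrite -addn1.
    by rewrite big_split/= sum_nat_const card_ord muln1 /n weightB.
  rewrite expr_sum -big_split/=; apply: eq_bigr => r _.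
  have -> : (z Y s)^-1 ^+ (i r - j r).+1 = \prod_(j r <= t < (i r).+1) (z Y s)^-1.
    by rewrite prodr_const_nat subSn.
  by rewrite -big_split/=; apply: eq_bigr => t _; rewrite invfM mulrC mulNr.
have Z0 : Z != 0 by apply/prodf_neq0 => s _.
have X0 : X != 0 by apply/prodf_neq0 => s _.
have eps0 : eps != 0.
  by apply/prodf_neq0 => r _; apply/prodf_neq0 => s _; rewrite oppr_eq0 oner_eq0.
have kappa0 : kappa != 0.
  apply/prodf_neq0 => r _; rewrite prodf_seq_neq0; apply/allP => t _.
  by rewrite /= oppr_eq0 invr_eq0 mulf_neq0 ?expf_neq0.
have P0 : \prod_(r < l.+1) \prod_(s < l.+1 | (r < s)%N) (1 - z Y s * z Y r) != 0.
  apply/prodf_neq0 => r _; apply/prodf_neq0 => s rs.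
  apply: one_sub_qnodes_neq0; rewrite -(inj_eq val_inj)/= gtn_eqF//.
have ZX : Z = X * q ^+ (weight Y - weight j).
  rewrite weightB// expr_sum -big_split/=; apply: eq_bigr => s _.
  by rewrite /z -mulrA -exprD subnKC.
have nc3V : (node_complement i j Y (fun s r t => - (z Y s * (x r * q ^+ t))^-1))^-1 =
    Z ^+ n.-1 * Z ^+ l * ((-1) ^+ l.+1 * (kappa ^+ l.+1)^-1).
  apply: (mulIf (x := kappa ^+ l.+1 * Z ^- (n + l.+1))).
    by rewrite mulf_neq0 ?invr_eq0 ?expf_neq0.
  rewrite -{1}nc3 mulKf; last first.
    apply/eqP => nc0; move: nc3; rewrite nc0 mul0r => /esym/eqP.
    by rewrite mulf_eq0 invr_eq0 !expf_eq0 (negPf Z0) (negPf kappa0) !andbF.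
  have -> : (n + l.+1 = n.-1 + l + 2)%N by rewrite /n; lia.
  rewrite !exprD; field.
  by rewrite Z0 !expf_neq0.
(* With [m = weight Y - weight j] the exponents add up to [m * n.-1], exactly the power of [q] in
   [Z ^+ n.-1]; this removes the dependence on [y]. *)
have qpow : q ^+ ('C(weight Y - weight j, 2) +
      (weight Y - weight j) * (weight i - weight Y)) *
    q ^+ 'C(weight Y - weight j, 2) = q ^+ ((weight Y - weight j) * n.-1).
  rewrite -exprD; congr (_ ^+ _).
  have -> : n.-1 = (weight Y - weight j + (weight i - weight Y)).-1.
    by rewrite /n; congr _.-1; lia.
  case: (weight Y - weight j)%N => [//|m].
  by have := sqrn_bin2 m.+1; rewrite addSn/=; nia.
have Zn : Z ^+ n.-1 = X ^+ n.-1 *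
    (q ^+ ('C(weight Y - weight j, 2) +
       (weight Y - weight j) * (weight i - weight Y)) *
     q ^+ 'C(weight Y - weight j, 2)) by rewrite ZX exprMn -exprM -qpow.
rewrite vander nc nc2 !invfM nc3V Zn /c.
move: E P0; rewrite -/X -/n.
set Ei := (mixed_qpoch q x i Y)^-1; set Ej := (mixed_qpoch q x Y j)^-1.
set qm := q ^+ (_ + _); set qC := q ^+ 'C(_, _).
set NC1 := (node_complement _ _ _ _)^-1.
set DX := \prod_(r < l.+1) \prod_(s < l.+1 | _) (- _).
set Dz := \prod_(r < l.+1) \prod_(s < l.+1 | _) (_ - _).
set A2 := (\prod_s \prod_r \prod_((Y _).+1 <= t < _) _)^-1.
set B2 := (\prod_s \prod_r \prod_(_ <= t < Y _) _)^-1.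
set Pz := \prod_(r < l.+1) \prod_(s < l.+1 | _) (1 - z Y _ * _).
set Px := \prod_(r < l.+1) \prod_(s < l.+1 | _) (1 - z j _ * _) => E P0.
transitivity (Ei * Ej * (A2 * B2) * Px / Pz *
  ((-1) ^+ (weight Y - weight j) * qC)); first by ring.
rewrite E.
transitivity (DX * X ^+ n * (qm * qC) * Dz * NC1 * (A2 * B2) * Px / Pz *
  ((-1) ^+ (weight Y - weight j) * (-1) ^+ (weight Y - weight j))); first by ring.
have signr_sqr p : (-1) ^+ p * (-1) ^+ p = 1 :> K by rewrite -expr2 sqrr_sign.
(* The signs from the node complement and from [signed_qpow] cancel; the resulting 1 is rewritten as
   the square of [(-1) ^+ l.+1] to match [c] and [nc3V]. *)
rewrite signr_sqr; move: (signr_sqr l.+1); set sl := (-1) ^+ l.+1 => sl2.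
rewrite -[X in _ * X = _]sl2; field.
by rewrite P0 eps0 !expf_neq0.
Qed.

Lemma MC_MCstar_diag i : MC q x i i * MCstar q x i i = 1.
Proof.
have [_ _ _ _ h] := dC.
rewrite MC_E// MCstar_E// mixed_qpoch_diag signed_qpowE// subnn !expr0 invr1.
rewrite !mul1r !mulr1 divff ?mulr1; last first.
  by apply/prodf_neq0 => r _; apply/prodf_neq0 => s rs;
    apply: one_sub_qnodes_neq0; rewrite -(inj_eq val_inj)/= gtn_eqF.
rewrite -invfM big1 ?mul1r.
  rewrite big1 ?invr1// => s _; apply: big1 => r _; exact: big_geq.
by move=> s _; apply: big1 => r _; exact: big_geq.
Qed.

Lemma inverse_lower_triangular_C : inverse_lower_triangular (MC q x) (MCstar q x).
Proof.
have Mt : box_triangular (MC q x).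
  move=> i j k ij; rewrite /MC; under eq_bigr do rewrite big_split/=.
  by rewrite big_split/= mixed_qpochV (mixed_qpochV_eq0 q0 (x0 k) ij) mul0r.
have Nt : box_triangular (MCstar q x).
  move=> i j k ij; rewrite /MCstar; under eq_bigr do rewrite big_split/=.
  by rewrite big_split/= mixed_qpochV (mixed_qpochV_eq0 q0 (x0 k) ij) !mul0r.
have MN := matprod_eq_delta MC_MCstar_diag MC_MCstar_box.
split=> //; try exact: box_triangularP.
exact: (inverse_box_triangular Mt Nt MN).
Qed.
End CaseC.

(* K is any field containing the complex numbers (through iota): K = R[i]
   gives complex parameters, K = R[i](a, x_1, ..., x_l) indeterminates. *)
Theorem mainTheorem1 (R : realType) (q : R[i]) (hq0 : 0 < `|q|)
    (hq1 : `|q| < 1) (K : fieldType) (iota : {rmorphism R[i] -> K})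
    (l : nat) (a : K) (x : 'I_l.+1 -> K) :
  (denominators_neq0_A (iota q) a x ->
     inverse_lower_triangular (MA (iota q) a x) (MAstar (iota q) a x)) /\
  (denominators_neq0_C (iota q) x ->
     inverse_lower_triangular (MC (iota q) x) (MCstar (iota q) x)).
Proof.
have q0 : iota q != 0 by rewrite fmorph_eq0 -normr_gt0.
(* Since [|q| < 1], [q] is not a root of unity, and [iota] is injective. *)
have q1 k : iota q ^+ k.+1 != 1.
  rewrite -rmorphXn fmorph_eq1; apply/eqP => /(congr1 (fun u => `|u|)).
  by apply/eqP; rewrite normrX normr1 lt_eqF// exprn_ilt1.
split=> d.
  exact: (inverse_lower_triangular_A q0 q1 d).
exact: (inverse_lower_triangular_C q0 q1 d).
Qed.
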